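(* Let $(X,d)$ and $(Y,\rho)$ be $T_1$ quasi-metric spaces, both with the property that forward convergence implies backward convergence. If $(Y,\rho)$ is left K-complete, $A\subseteq X$, and $f:(A,d)\to(Y,\rho)$ is a left K-Cauchy regular function, then there is a unique extension $\bar f:(Cl^+A,d)\to(Y,\rho)$ of $f$ such that $\bar f$ is left K-Cauchy regular.
   Context: A quasi-metric on a set $X$ is a function $d:X\times X\to\mathbb{R}$ such that for all $x,y,z\in X$: $d(x,y)\ge 0$ and $d(x,x)=0$; $d(x,y)=0=d(y,x)$ implies $x=y$; and $d(x,y)\le d(x,z)+d(z,y)$ (symmetry is not required). Put $B^+(x,\epsilon)=\{y\in X:d(x,y)<\epsilon\}$; the forward topology $\tau(d)$ is the topology generated by these balls. $(X,d)$ is $T_1$ if $\tau(d)$ is $T_1$ (equivalently, $d(x,y)>0$ whenever $x\ne y$). $Cl^+A$ denotes the closure of $A$ in $\tau(d)$. Subsets carry the restricted quasi-metric, also denoted $d$. A sequence $(x_n)$ is forward convergent to $x$ if $\lim_n d(x,x_n)=0$, and backward convergent to $x$ if $\lim_n d(x_n,x)=0$. The property ''forward convergence implies backward convergence'' means: whenever a sequence is forward convergent to a point, it is backward convergent to that point. A sequence $(x_n)$ is left K-Cauchy if for every $\epsilon>0$ there is $n_0\in\mathbb{N}$ such that $d(x_k,x_n)<\epsilon$ whenever $n_0\le k\le n$. A quasi-metric space is left K-complete if every left K-Cauchy sequence in it is forward convergent to some point of it. A map between quasi-metric spaces is left K-Cauchy regular if it maps left K-Cauchy sequences to left K-Cauchy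 sequences. *)

(* Defs.v *)
From HB Require Import structures.
From mathcomp Require Import all_boot all_order all_algebra.
From mathcomp Require Import all_classical all_reals all_analysis.
Import Order.TTheory GRing.Theory Num.Theory.
Import numFieldNormedType.Exports.

Set Implicit Arguments.
Unset Strict Implicit.
Unset Printing Implicit Defensive.

Local Open Scope classical_set_scope.
Local Open Scope ring_scope.

Record quasiMetric (R : realType) (X : Type) := QuasiMetric {
  qdist :> X -> X -> R;
  qdist_ge0 : forall x y, 0 <= qdist x y;
  qdist_xx : forall x, qdist x x = 0;
  qdist_sep : forall x y, qdist x y = 0 -> qdist y x = 0 -> x = y;
  qdist_triangle : forall x y z, qdist x y <= qdist x z + qdist z y }.

Definition forward_ball (R : realType) (X : Type) (d : quasiMetric R X)
    (x : X) (e : R) : set X :=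
  [set y | d x y < e].

(* An alias of X carrying the forward topology of d, with the forward balls as
   a subbase. *)
Definition forwardSpace (R : realType) (X : Type) (d : quasiMetric R X) : Type :=
  X.

HB.instance Definition _ (R : realType) (X : Type) (d : quasiMetric R X) :=
  gen_eqMixin (forwardSpace d).
HB.instance Definition _ (R : realType) (X : Type) (d : quasiMetric R X) :=
  gen_choiceMixin (forwardSpace d).
HB.instance Definition _ (R : realType) (X : Type) (d : quasiMetric R X) :=
  isSubBaseTopological.Build (forwardSpace d)
    [set B : set (forwardSpace d) |
      exists (x : X) (e : R), 0 < e /\ B = forward_ball d x e]
    id.

Definition T1_quasi_metric (R : realType) (X : Type) (d : quasiMetric R X) :=
  accessible_space (forwardSpace d).

Definition forward_closure (R : realType) (X : Type) (d : quasiMetric R X)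
    (A : set X) : set X :=
  closure (A : set (forwardSpace d)).

Definition forward_cvg (R : realType) (X : Type) (d : quasiMetric R X)
    (x_ : nat -> X) (x : X) :=
  d x (x_ n) @[n --> \oo] --> (0 : R).

Definition backward_cvg (R : realType) (X : Type) (d : quasiMetric R X)
    (x_ : nat -> X) (x : X) :=
  d (x_ n) x @[n --> \oo] --> (0 : R).

Definition forward_cvg_implies_backward_cvg (R : realType) (X : Type)
    (d : quasiMetric R X) :=
  forall (x_ : nat -> X) (x : X), forward_cvg d x_ x -> backward_cvg d x_ x.

Definition left_K_cauchy (R : realType) (X : Type) (d : quasiMetric R X)
    (x_ : nat -> X) :=
  forall e : R, 0 < e ->
    exists n0 : nat, forall k n : nat,
      (n0 <= k)%N -> (k <= n)%N -> d (x_ k) (x_ n) < e.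

Definition left_K_complete (R : realType) (X : Type) (d : quasiMetric R X) :=
  forall x_ : nat -> X, left_K_cauchy d x_ -> exists x : X, forward_cvg d x_ x.

Definition left_K_cauchy_regular (R : realType) (X Y : Type)
    (d : quasiMetric R X) (rho : quasiMetric R Y) (f : X -> Y) :=
  forall x_ : nat -> X, left_K_cauchy d x_ -> left_K_cauchy rho (f \o x_).

Section Restriction.
Variables (R : realType) (X : Type) (d : quasiMetric R X) (A : set X).

Let dA (x y : A) : R := d (val x) (val y).

Let dA_ge0 x y : 0 <= dA x y. Proof. exact: qdist_ge0. Qed.

Let dA_xx x : dA x x = 0. Proof. exact: qdist_xx. Qed.

Let dA_sep x y : dA x y = 0 -> dA y x = 0 -> x = y.
Proof. by move=> xy yx; apply: val_inj; exact: qdist_sep xy yx. Qed.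

Let dA_triangle x y z : dA x y <= dA x z + dA z y.
Proof. exact: qdist_triangle. Qed.

Definition restrict_qm : quasiMetric R A :=
  QuasiMetric dA_ge0 dA_xx dA_sep dA_triangle.

Lemma sub_forward_closure : A `<=` forward_closure d A.
Proof. exact: (@subset_closure (forwardSpace d) A). Qed.

Definition forward_closure_incl (a : A) : forward_closure d A :=
  exist _ (val a) (mem_set (sub_forward_closure (set_mem (valP a)))).

End Restriction.

(* Main.v *)
(** Under "forward implies backward", a sequence of [A] converging to a point
    [x] of the closure is left K-Cauchy, so its image has a limit; interlacing
    two such sequences shows that the limit depends only on [x], and
    interlacing with the constant sequence [x] shows that a regular extension
    must take this value at [x].  For regularity, a left K-Cauchy sequence
    [x_n] of the closure is replaced by points [a_n] of [A] with both
    [a_n] close to [x_n] and [f a_n] close to the extended value at [x_n], in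
    both directions. *)
Require Import Defs.
From mathcomp Require Import all_boot all_order all_algebra.
From mathcomp Require Import all_classical all_reals all_analysis.
From mathcomp Require Import zify lra.
Import Order.TTheory GRing.Theory Num.Theory.
Import numFieldNormedType.Exports.

Set Implicit Arguments.
Unset Strict Implicit.
Unset Printing Implicit Defensive.

Local Open Scope classical_set_scope.
Local Open Scope ring_scope.

Lemma cvg0_nnegP (R : realType) (r : nat -> R) : (forall n, 0 <= r n) ->
  r n @[n --> \oo] --> (0 : R) <->
  forall e, 0 < e -> exists N, forall n, (N <= n)%N -> r n < e.
Proof.
move=> r0; split=> [/cvgrPdist_lt r_cvg e e0|r_lt].
  have [N _ rN] := r_cvg _ e0; exists N => n /rN.
  by rewrite /= sub0r normrN ger0_norm.
apply/cvgrPdist_lt => e e0; have [N rN] := r_lt _ e0.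
by exists N => // n /= /rN; rewrite sub0r normrN ger0_norm.
Qed.

Definition interlace (T : Type) (u v : nat -> T) (n : nat) : T :=
  if odd n then v n./2 else u n./2.

Lemma interlace_double (T : Type) (u v : nat -> T) n :
  interlace u v n.*2 = u n.
Proof. by rewrite /interlace odd_double doubleK. Qed.

Lemma interlace_doubleS (T : Type) (u v : nat -> T) n :
  interlace u v n.*2.+1 = v n.
Proof. by rewrite /interlace /= odd_double /= uphalf_double. Qed.

Lemma comp_interlace (T U : Type) (f : T -> U) (u v : nat -> T) :
  f \o interlace u v = interlace (f \o u) (f \o v).
Proof. by apply/funext => n; rewrite /interlace /=; case: odd. Qed.

Section QuasiMetric.
Variables (R : realType) (X : Type) (d : quasiMetric R X).

Lemma forward_cvgP (u : nat -> X) x : forward_cvg d u x <->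
  forall e, 0 < e -> exists N, forall n, (N <= n)%N -> d x (u n) < e.
Proof. by apply: cvg0_nnegP => n; exact: qdist_ge0. Qed.

Lemma backward_cvgP (u : nat -> X) x : backward_cvg d u x <->
  forall e, 0 < e -> exists N, forall n, (N <= n)%N -> d (u n) x < e.
Proof. by apply: cvg0_nnegP => n; exact: qdist_ge0. Qed.

Lemma forward_cvg_cst x : forward_cvg d (fun=> x) x.
Proof. by apply/forward_cvgP => e e0; exists 0%N => n _; rewrite qdist_xx. Qed.

Lemma forward_cvg_interlace (u v : nat -> X) x :
  forward_cvg d (interlace u v) x <-> forward_cvg d u x /\ forward_cvg d v x.
Proof.
split=> [/forward_cvgP w_cvg|[/forward_cvgP u_cvg /forward_cvgP v_cvg]].
  split; apply/forward_cvgP => e /w_cvg[N wN]; exists N => n Nn.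
    by rewrite -(interlace_double u v); apply: wN; lia.
  by rewrite -(interlace_doubleS u v); apply: wN; lia.
apply/forward_cvgP => e e0; have [M uM] := u_cvg _ e0; have [N vN] := v_cvg _ e0.
(* Position [n] shows the term of index [n./2], hence the doubled thresholds. *)
exists (M.*2 + N.*2)%N => n n_ge; rewrite /interlace.
by case: ifP => _; [apply: vN | apply: uM]; lia.
Qed.

(** The ball of radius [1/(n+1)] around [x] is a neighbourhood of [x], so it meets [A]; countably
    many choices give the sequence. *)
Lemma forward_closure_cvg (A : set X) x : forward_closure d A x ->
  exists u : nat -> A, forward_cvg d (val \o u) x.
Proof.
move=> Ax; have near_x (n : nat) : exists a : A, d x (val a) < n.+1%:R^-1.
  have e0 : 0 < n.+1%:R^-1 :> R by rewrite invr_gt0 ltr0n.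
  have /Ax[y [Ay xy]] :
      nbhs (x : forwardSpace d) (forward_ball d x n.+1%:R^-1).
    apply: open_nbhs_nbhs; split; last by rewrite /forward_ball /= qdist_xx.
    (* Open sets are unions of finite intersections of subbasic sets; here the union has a single
       member. *)
    exists [set forward_ball d x n.+1%:R^-1]; last by rewrite bigcup_set1.
    by move=> _ ->; apply: finI_from1; exists x, n.+1%:R^-1.
  by exists (exist _ y (mem_set Ay)).
have [u u_lt] := choice near_x; exists u; apply/forward_cvgP => e e0.
have [N _ Ne] := near_infty_natSinv_lt (PosNum e0).
by exists N => n /Ne; apply: lt_trans; exact: u_lt.
Qed.

Hypothesis fwd_bwd : forward_cvg_implies_backward_cvg d.

Lemma forward_cvg_close (u : nat -> X) x e : forward_cvg d u x -> 0 < e ->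
  exists N, forall n, (N <= n)%N -> d x (u n) < e /\ d (u n) x < e.
Proof.
move=> ux e0; have [M uM] := (forward_cvgP u x).1 ux _ e0.
have [N uN] := (backward_cvgP u x).1 (fwd_bwd ux) _ e0.
by exists (M + N)%N => n n_ge; split; [apply: uM | apply: uN]; lia.
Qed.

(** The detour through [x] costs [d (u k) x + d x (u n)]; the first term is small only by backward
    convergence. *)
Lemma forward_cvg_left_K_cauchy (u : nat -> X) x :
  forward_cvg d u x -> left_K_cauchy d u.
Proof.
move=> ux e e0; have e20 : 0 < e / 2 by lra.
have [N uN] := forward_cvg_close ux e20.
exists N => k n Nk kn; have [_ ukx] := uN _ Nk.
have [xun _] := uN _ (leq_trans Nk kn).
by have := qdist_triangle d (u k) (u n) x; lra.
Qed.

(** Passing through a late term [v n] gives [d z t <= d z (v n) + d (v n) t], small by forward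
    convergence to [z] and backward convergence to [t]. Exchanging the limits kills the other
    distance, as [qdist_sep] requires. *)
Lemma forward_cvg_unique (u : nat -> X) x y :
  forward_cvg d u x -> forward_cvg d u y -> x = y.
Proof.
have le0 (v : nat -> X) z t :
    forward_cvg d v z -> forward_cvg d v t -> d z t = 0.
  move=> vz vt; apply/eqP; rewrite eq_le qdist_ge0 andbT.
  apply/ler_addgt0Pr => e e0; rewrite add0r; have e20 : 0 < e / 2 by lra.
  have [M vM] := forward_cvg_close vz e20.
  have [N vN] := forward_cvg_close vt e20.
  have [zv _] := vM (M + N)%N (leq_addr _ _).
  have [_ tv] := vN (M + N)%N (leq_addl _ _).
  by have := qdist_triangle d z t (v (M + N)%N); lra.
by move=> ux uy; apply: (@qdist_sep _ _ d); apply: (le0 u).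
Qed.

End QuasiMetric.

Section Extension.
Variables (R : realType) (X Y : Type).
Variables (d : quasiMetric R X) (rho : quasiMetric R Y).
Hypothesis fwd_bwd_X : forward_cvg_implies_backward_cvg d.
Hypothesis fwd_bwd_Y : forward_cvg_implies_backward_cvg rho.
Hypothesis complete_Y : left_K_complete rho.

(** Stated for any [B] because it serves twice: for [f] on [A] to define the extension, and for a
    rival extension on the closure to prove uniqueness. *)
Lemma regular_forward_cvg (B : set X) (h : B -> Y) (u v : nat -> B) x y :
  left_K_cauchy_regular (restrict_qm d B) rho h ->
  forward_cvg d (val \o u) x -> forward_cvg d (val \o v) x ->
  forward_cvg rho (h \o u) y -> forward_cvg rho (h \o v) y.
Proof.
move=> h_reg ux vx huy.
have w_cauchy : left_K_cauchy (restrict_qm d B) (interlace u v).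
  (* The limit [x] may lie outside [B], so the Cauchy property is obtained in [X]; the restricted
     distance is that of the values. *)
  have : forward_cvg d (val \o interlace u v) x.
    by rewrite comp_interlace; apply/forward_cvg_interlace.
  exact: forward_cvg_left_K_cauchy.
have [z] := complete_Y (h_reg _ w_cauchy).
rewrite comp_interlace => /forward_cvg_interlace[huz hvz].
by rewrite (forward_cvg_unique fwd_bwd_Y huy huz).
Qed.

Variables (A : set X) (f : A -> Y).
Hypothesis f_regular : left_K_cauchy_regular (restrict_qm d A) rho f.

(** The value [y] is chosen before [u], so that the choice of [y] alone defines the extension at
    [x]. *)
Lemma regular_limit x : forward_closure d A x -> exists y : Y,
  forall u : nat -> A, forward_cvg d (val \o u) x -> forward_cvg rho (f \o u) y.
Proof.
move=> Ax; have [u ux] := forward_closure_cvg Ax.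
have u_cauchy : left_K_cauchy (restrict_qm d A) u.
  exact: (forward_cvg_left_K_cauchy fwd_bwd_X ux).
have [y fuy] := complete_Y (f_regular u_cauchy).
by exists y => v vx; exact: regular_forward_cvg f_regular ux vx fuy.
Qed.

Lemma limit_extension_regular (g : forward_closure d A -> Y) :
  (forall x (u : nat -> A), forward_cvg d (val \o u) (val x) ->
     forward_cvg rho (f \o u) (g x)) ->
  left_K_cauchy_regular (restrict_qm d (forward_closure d A)) rho g.
Proof.
move=> g_lim x x_cauchy.
have approx n : exists a : A,
    [/\ d (val (x n)) (val a) < n.+1%:R^-1, d (val a) (val (x n)) < n.+1%:R^-1,
        rho (g (x n)) (f a) < n.+1%:R^-1 & rho (f a) (g (x n)) < n.+1%:R^-1].
  have e0 : 0 < n.+1%:R^-1 :> R by rewrite invr_gt0 ltr0n.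
  have [u ux] := forward_closure_cvg (set_mem (valP (x n))).
  have [M uM] := forward_cvg_close fwd_bwd_X ux e0.
  have [N uN] := forward_cvg_close fwd_bwd_Y (g_lim _ _ ux) e0.
  have [? ?] := uM (M + N)%N (leq_addr _ _).
  by have [? ?] := uN (M + N)%N (leq_addl _ _); exists (u (M + N)%N).
have [a a_close] := choice approx.
have a_cauchy : left_K_cauchy (restrict_qm d A) a.
  (* Three legs of length below [e / 3]: from [a k] to [x k], to [x n], to [a n]. *)
  move=> e e0; have e30 : 0 < e / 3 by lra.
  have [M xM] := x_cauchy _ e30.
  have [N _ Ne] := near_infty_natSinv_lt (PosNum e30).
  exists (M + N)%N => k n k_ge kn.
  have [_ axk _ _] := a_close k; have [xan _ _ _] := a_close n.
  have xkn : d (val (x k)) (val (x n)) < e / 3.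
    exact: xM k n (leq_trans (leq_addr _ _) k_ge) kn.
  have /= Nk := Ne k (leq_trans (leq_addl _ _) k_ge).
  have /= Nn := Ne n (leq_trans (leq_trans (leq_addl _ _) k_ge) kn).
  have {}axk := lt_trans axk Nk; have {}xan := lt_trans xan Nn.
  change (d (val (a k)) (val (a n)) < e).
  have := qdist_triangle d (val (a k)) (val (a n)) (val (x k)).
  have := qdist_triangle d (val (x k)) (val (a n)) (val (x n)).
  by lra.
(* The same path in [Y] with the roles exchanged: from [g (x k)] to [f (a k)], to [f (a n)], to
   [g (x n)]. *)
move=> e e0; have e30 : 0 < e / 3 by lra.
have [M faM] := f_regular a_cauchy e30.
have [N _ Ne] := near_infty_natSinv_lt (PosNum e30).
exists (M + N)%N => k n k_ge kn.
have [_ _ gfk _] := a_close k; have [_ _ _ fgn] := a_close n.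
have /= fakn := faM k n (leq_trans (leq_addr _ _) k_ge) kn.
have /= Nk := Ne k (leq_trans (leq_addl _ _) k_ge).
have /= Nn := Ne n (leq_trans (leq_trans (leq_addl _ _) k_ge) kn).
have {}gfk := lt_trans gfk Nk; have {}fgn := lt_trans fgn Nn.
have := qdist_triangle rho (g (x k)) (g (x n)) (f (a k)).
have := qdist_triangle rho (f (a k)) (g (x n)) (f (a n)).
by rewrite /=; lra.
Qed.

End Extension.

Theorem theorem4p8 (R : realType) (X Y : Type)
    (d : quasiMetric R X) (rho : quasiMetric R Y)
    (T1_X : T1_quasi_metric d) (T1_Y : T1_quasi_metric rho)
    (fwd_bwd_X : forward_cvg_implies_backward_cvg d)
    (fwd_bwd_Y : forward_cvg_implies_backward_cvg rho)
    (complete_Y : left_K_complete rho)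
    (A : set X) (f : A -> Y)
    (f_regular : left_K_cauchy_regular (restrict_qm d A) rho f) :
  exists! g : forward_closure d A -> Y,
    (forall a : A, g (forward_closure_incl d a) = f a) /\
    left_K_cauchy_regular (restrict_qm d (forward_closure d A)) rho g.
Proof.
have lim (x : forward_closure d A) : exists y, forall u : nat -> A,
    forward_cvg d (val \o u) (val x) -> forward_cvg rho (f \o u) y.
  exact: regular_limit (set_mem (valP x)).
have [g g_lim] := choice lim.
exists g; split; first split.
(* The constant sequence [a] converges to [a], so its constant image tends both to the extended
   value and to [f a]. *)
- move=> a; apply: (forward_cvg_unique fwd_bwd_Y (u := fun=> f a)).
    exact: g_lim (forward_closure_incl d a) (fun=> a) (forward_cvg_cst _ _).
  exact: forward_cvg_cst.
- exact: limit_extension_regular g_lim.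
- move=> h [h_ext h_regular]; apply/funext => x.
  have [u ux] := forward_closure_cvg (set_mem (valP x)).
  have hu_cvg : forward_cvg rho (h \o (@forward_closure_incl _ _ d A \o u)) (g x).
    suff -> : h \o (@forward_closure_incl _ _ d A \o u) = f \o u by exact: g_lim.
    by apply/funext => n; exact: h_ext.
  (* In the closure, [u] and the constant sequence [x] share the limit [x], so their images under
     [h] share the limit [g x]. *)
  have hx_cvg : forward_cvg rho (h \o (fun=> x)) (g x).
    apply: (regular_forward_cvg fwd_bwd_X fwd_bwd_Y complete_Y h_regular
      _ (forward_cvg_cst d (val x)) hu_cvg).
    exact: ux.
  exact: (forward_cvg_unique fwd_bwd_Y hx_cvg (forward_cvg_cst rho (h x))).
Qed.
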